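(* Let $K$ be a field of characteristic zero. If $(a,b)\in\mathbb{N}_0\times\mathbb{N}_0$ is a possible last lower corner, then $b<a$ and $b\le(a-b-1)^2$.
   Context: $\mathbb{N}=\{1,2,\dots\}$, $\mathbb{N}_0=\mathbb{N}\cup\{0\}$, $L=K[x,y]$, $[P,Q]=\partial_xP\,\partial_yQ-\partial_xQ\,\partial_yP$. A direction is a pair $(\rho,\sigma)\in\mathbb{Z}^2$ with $\gcd(\rho,\sigma)=1$. Let $\mathcal{D}$ be the set of directions lying strictly between $(0,-1)$ and $(1,-1)$ counterclockwise, i.e. with $\rho>0$ and $\rho+\sigma<0$; it is ordered counterclockwise: $(\rho,\sigma)<(\rho',\sigma')$ iff $\rho\sigma'-\sigma\rho'>0$. For $(\rho,\sigma)\in\mathcal{D}$ and a point $(a,b)$ write $v_{\rho,\sigma}(a,b)=\rho a+\sigma b$; also $v_{1,-1}(a,b)=a-b$. A polynomial $R$ is $(\rho,\sigma)$-homogeneous if $v_{\rho,\sigma}$ is constant on its support; for such nonzero $R$, $\operatorname{st}_{\rho,\sigma}(R)$ (resp. $\operatorname{en}_{\rho,\sigma}(R)$) is the support point with smallest (resp. largest) second coordinate. An admissible chain of length $k\in\mathbb{N}_0$ is a triple of families $\bigl((C_j)_{0\le j\le k},(R_j)_{1\le j\le k},(\rho_j,\sigma_j)_{1\le j\le k}\bigr)$ with $C_j\in\mathbb{N}_0\times\mathbb{N}_0$, $R_j\in L$, $(\rho_j,\sigma_j)\in\mathcal{D}$, such that: (1) $C_0=(l,0)$ for some $l\in\mathbb{N}$;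 (2) $(\rho_j,\sigma_j)>(\rho_{j-1},\sigma_{j-1})$ for $2\le j\le k$; and for each $1\le j\le k$: (3) $R_j$ is $(\rho_j,\sigma_j)$-homogeneous and is not a monomial; (4) $C_{j-1}=\operatorname{st}_{\rho_j,\sigma_j}(R_j)$; (5) $C_j=\operatorname{en}_{\rho_j,\sigma_j}(R_j)$; (6) $v_{1,-1}(C_j)>0$; (7) $v_{\rho_j,\sigma_j}(C_j)\ge\rho_j$; (8) there exist a $(\rho_j,\sigma_j)$-homogeneous $G_j\in L$ and $i_j\in\mathbb{N}$ such that $[G_j,R_j]=R_j^{i_j}$. A point $(a,b)\in\mathbb{N}_0\times\mathbb{N}_0$ is a possible last lower corner if there is an admissible chain (of some length $k$) with $C_k=(a,b)$. *)

(* Defs.v *)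
From mathcomp Require Import all_boot all_order all_algebra.
From mathcomp Require Import mpoly.

Set Implicit Arguments.
Unset Strict Implicit.
Unset Printing Implicit Defensive.

Import Order.TTheory GRing.Theory Num.Theory.
Local Open Scope ring_scope.

Definition point : Type := (nat * nat)%type.
Definition direction : Type := (int * int)%type.

(* gcd(rho, sigma) = 1, and strictly between (0,-1) and (1,-1) *)
Definition in_D (d : direction) : Prop :=
  [/\ coprimez d.1 d.2, 0 < d.1 & d.1 + d.2 < 0].

(* the counterclockwise order; only meaningful on in_D *)
Definition dir_lt (d d' : direction) : Prop :=
  0 < d.1 * d'.2 - d.2 * d'.1.

Definition v (d : direction) (p : point) : int :=
  d.1 * (p.1)%:Z + d.2 * (p.2)%:Z.

Section Polynomials.

Variable K : fieldType.

(* K[x,y], with x the variable of index ord0 and y that of index ord_max *)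
Local Notation L := {mpoly K[2]}.

Definition bracket (P Q : L) : L :=
  P^`M(ord0) * Q^`M(ord_max) - Q^`M(ord0) * P^`M(ord_max).

Definition supp (P : L) : seq point :=
  [seq ((m : 'X_{1..2}) ord0, m ord_max) | m <- msupp P].

Definition homogeneous (d : direction) (P : L) : Prop :=
  {in supp P &, forall p q, v d p = v d q}.

(* Monomials may carry a coefficient; a non-monomial is in particular
   nonzero. *)
Definition is_monomial (P : L) : Prop :=
  exists (c : K) (m : 'X_{1..2}), P = c *: 'X_[m].

(* "p = st_{rho,sigma}(R)" and "p = en_{rho,sigma}(R)" for a nonzero
   (rho,sigma)-homogeneous R with rho > 0: two distinct support points of such
   an R have distinct second coordinates, so that p is unique.  The direction
   plays no role beyond the homogeneity of R. *)
Definition is_st (R : L) (p : point) : Prop :=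
  p \in supp R /\ {in supp R, forall q, (p.2 <= q.2)%N}.

Definition is_en (R : L) (p : point) : Prop :=
  p \in supp R /\ {in supp R, forall q, (q.2 <= p.2)%N}.

(* The families C_0..C_k, R_1..R_k, d_1..d_k are functions on nat, whose values
   outside of the indicated ranges are irrelevant. *)
Record admissible_chain (k : nat) (C : nat -> point) (R : nat -> L)
    (d : nat -> direction) : Prop := AdmissibleChain {
  chain_dir : forall j, (1 <= j <= k)%N -> in_D (d j);
  chain_start : exists l : nat, (0 < l)%N /\ C 0%N = (l, 0%N);
  chain_incr : forall j, (2 <= j <= k)%N -> dir_lt (d j.-1) (d j);
  chain_homog : forall j, (1 <= j <= k)%N ->
    homogeneous (d j) (R j) /\ ~ is_monomial (R j);
  chain_st : forall j, (1 <= j <= k)%N -> is_st (R j) (C j.-1);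
  chain_en : forall j, (1 <= j <= k)%N -> is_en (R j) (C j);
  chain_diag : forall j, (1 <= j <= k)%N -> 0 < v (1, -1) (C j);
  chain_val : forall j, (1 <= j <= k)%N -> (d j).1 <= v (d j) (C j);
  chain_bracket : forall j, (1 <= j <= k)%N ->
    exists (G : L) (i : nat),
      [/\ homogeneous (d j) G, (0 < i)%N & bracket G (R j) = R j ^+ i]
}.

Definition possible_last_lower_corner (p : point) : Prop :=
  exists (k : nat) (C : nat -> point) (R : nat -> L) (d : nat -> direction),
    admissible_chain k C R d /\ C k = p.

End Polynomials.

(* Main.v *)
Require Import Defs.
From Stdlib Require Import Classical.
From mathcomp Require Import all_boot all_order all_algebra.
From mathcomp Require Import mpoly.
From mathcomp Require Import zify ring.

Import Order.TTheory GRing.Theory Num.Theory.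
Local Open Scope ring_scope.

Set Implicit Arguments.
Unset Strict Implicit.
Unset Printing Implicit Defensive.

(* The bound b <= (a - b - 1)^2 propagates along a chain, one edge at a time.
   Let an edge go from (p, q) in direction (rho, sigma), let
   tau = - (rho + sigma) > 0 and w = rho p + sigma q >= rho, and let its end be
   (p - sigma t, q + rho t).  Putting x = 1 turns R and G into y^q f(y^rho) and
   y^n g(y^rho) with f(0), g(0) nonzero and deg f = t, and by Euler's identity
   [G, R] = R^i becomes an ODE: W G R' - w R G' = rho R^i with
   W = (i - 1) w - tau.
   If the lowest order terms in y cancel on the left, then W q = w n, and as
   n = (i - 1) q + 1 modulo rho this forces rho <= p - q.
   Otherwise n = (i - 1) q + 1.  If moreover w > tau t, then at every
   irreducible factor of f, of multiplicity m say, the ODE rules out a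
   multiplicity of g below (i - 1) m, since that would need tau m to be a
   positive multiple of w although m <= t.  Hence f^(i-1) divides g; the
   quotient h satisfies f | h f', so it is not constant, and comparing top
   degrees gives a contradiction.  So w <= tau t.
   Both rho <= p - q and w <= tau t are enough to propagate the bound. *)

(** * Irreducible factors and multiplicities of polynomials in one variable *)

Lemma intr_char0_eq0 (K : fieldType) (charK : [pchar K] =i pred0) (z : int) :
  (z%:~R == 0 :> K) = (z == 0).
Proof.
have natE := (pcharf0P K).1 charK.
by case: z => n; rewrite ?NegzE ?mulrNz ?oppr_eq0 natE.
Qed.

Lemma irreducible_divisor (F : fieldType) (p : {poly F}) :
  (1 < size p)%N -> exists2 r : {poly F}, irreducible_poly r & r %| p.
Proof.
have [n] := ubnP (size p); elim: n p => // n IHn p lt_pn p_gt1.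
(* Irreducibility over an arbitrary field is not decidable, hence the classical case split. *)
have [irr_p | red_p] := classic (irreducible_poly p); first by exists p.
have [d [d_neq1 d_dvd d_neqp]] :
    exists d : {poly F}, [/\ size d != 1%N, d %| p & ~~ (d %= p)].
  apply: NNPP => no_d; apply: red_p; split=> // d d1 dp.
  by apply/negPn/negP => ndp; apply: no_d; exists d.
have p_neq0 : p != 0 by rewrite -size_poly_gt0 ltnW.
have d_neq0 : d != 0 by apply: contraTneq d_dvd => ->; rewrite dvd0p.
have lt_dp : (size d < size p)%N.
  by rewrite ltn_neqAle dvdp_size_eqp // d_neqp dvdp_leq.
have [||r irr_r rd] := IHn d.
- exact: leq_trans lt_dp _.
- by rewrite ltn_neqAle eq_sym d_neq1 size_poly_gt0.
by exists r => //; apply: dvdp_trans rd d_dvd.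
Qed.

Lemma dvdp_power_factor (F : fieldType) (r p : {poly F}) :
    (1 < size r)%N -> p != 0 ->
  exists (k : nat) (q : {poly F}), p = r ^+ k * q /\ ~~ (r %| q).
Proof.
move=> r_gt1; have [n] := ubnP (size p); elim: n p => // n IHn p lt_pn p_neq0.
have [/dvdpP[q p_eq] | rNp] := boolP (r %| p); last first.
  by exists 0%N, p; rewrite mul1r.
have q_neq0 : q != 0 by apply: contraNneq p_neq0 => q0; rewrite p_eq q0 mul0r.
have r_neq0 : r != 0 by rewrite -size_poly_gt0 ltnW.
have [|k [u [q_eq rNu]]] := IHn q _ q_neq0.
  have size_p : size p = (size q + size r).-1 by rewrite p_eq size_mul.
  lia.
by exists k.+1, u; rewrite p_eq q_eq exprSr; split=> //; ring.
Qed.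

Lemma irreducible_coprime (F : fieldType) (r q : {poly F}) :
  irreducible_poly r -> ~~ (r %| q) -> coprimep r q.
Proof.
move=> [r_gt1 irr_r]; apply: contraNT => gcd_neq1.
have /eqp_dvdl <- := irr_r _ gcd_neq1 (dvdp_gcdl r q).
exact: dvdp_gcdr.
Qed.

(** In characteristic zero the derivative of a nonconstant polynomial is nonzero, and its degree is
    too small for [r] to divide it. *)
Lemma irreducible_coprime_deriv (F : fieldType) (r : {poly F}) :
  [pchar F] =i pred0 -> irreducible_poly r -> coprimep r r^`().
Proof.
move=> charF irr_r; apply: irreducible_coprime => //.
have r_gt1 := irr_r.1; have r_neq0 := irredp_neq0 irr_r.
have r'_neq0 : r^`() != 0.
  apply: contraTneq r_gt1 => /(congr1 (fun p : {poly F} => p`_(size r).-2)).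
  case size_r : (size r) => [|[|n]] //.
  rewrite coefE /= coef0 -mulr_natr => /eqP.
  rewrite mulf_eq0 ((pcharf0P F).1 charF) orbF => /eqP r0.
  by have := lead_coef_eq0 r; rewrite lead_coefE size_r /= r0 eqxx (negPf r_neq0).
by apply/negP => /(dvdp_leq r'_neq0); rewrite leqNgt lt_size_deriv.
Qed.

(** Dividing by [c], the gcd, leaves coprime cofactors, and that of [A] is not constant. An
    irreducible factor [r] of it does not divide the cofactor of [B], so [r] has the same
    multiplicity in [B] as in [c], and a larger one in [A]. *)
Lemma ndvdp_irreducible_power (F : fieldType) (A B : {poly F}) :
    A != 0 -> B != 0 -> ~~ (A %| B) ->
  exists (r v : {poly F}) (k : nat),
    [/\ irreducible_poly r, B = r ^+ k * v, ~~ (r %| v) & r ^+ k.+1 %| A].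
Proof.
move=> A_neq0 B_neq0 ndvAB; set c := gcdp A B.
have A_eq : A = A %/ c * c by rewrite divpK ?dvdp_gcdl.
have B_eq : B = B %/ c * c by rewrite divpK ?dvdp_gcdr.
have c_neq0 : c != 0 by rewrite gcdp_eq0 (negPf A_neq0).
have co_uw : coprimep (A %/ c) (B %/ c) by rewrite coprimep_div_gcd ?A_neq0.
have u_neq0 : A %/ c != 0 by apply: contraNneq A_neq0 => u0; rewrite A_eq u0 mul0r.
have u_gt1 : (1 < size (A %/ c)%R)%N.
  rewrite ltn_neqAle size_poly_gt0 u_neq0 andbT eq_sym.
  apply: contraNN ndvAB => u1; rewrite [B]B_eq A_eq.
  have : A %/ c %= 1 by rewrite -size_poly_eq1.
  by move=> /(eqp_mulr c) /eqp_dvdl ->; rewrite mul1r dvdp_mull.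
have [r irr_r ru] := irreducible_divisor u_gt1.
have [k [c' [c_eq rNc']]] := dvdp_power_factor irr_r.1 c_neq0.
exists r, (c' * (B %/ c)), k; split=> //.
- by rewrite mulrA -c_eq mulrC.
- rewrite Gauss_dvdpr ?irreducible_coprime //.
  apply/negP => rw; have := dvdp_gcd r (A %/ c) (B %/ c).
  rewrite ru rw => /dvdp_leq; rewrite (eqP co_uw) -size_poly_gt0 (eqP co_uw).
  by move=> /(_ isT); rewrite leqNgt irr_r.1.
- by rewrite A_eq exprS dvdp_mul // c_eq dvdp_mulr.
Qed.

(** * The differential equation in one variable *)

Lemma coefM_top (R : nzRingType) (p q : {poly R}) (a b : nat) :
  (size p <= a.+1)%N -> (size q <= b.+1)%N -> (p * q)`_(a + b) = p`_a * q`_b.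
Proof.
move=> size_p size_q; have lt_a : (a < (a + b).+1)%N by rewrite ltnS leq_addr.
rewrite coefM (bigD1 (Ordinal lt_a)) //= addKn big1 ?addr0 // => j.
rewrite -val_eqE /= => j_neq; have [lt_ja | le_aj] := ltnP j a.
  by rewrite [q`__]nth_default ?mulr0 //; apply: leq_trans size_q _; lia.
by rewrite [p`__]nth_default ?mul0r //; apply: leq_trans size_p _; lia.
Qed.

Lemma coef_mulX_deriv (R : nzRingType) (p : {poly R}) (j : nat) :
  ('X * p^`())`_j = p`_j *+ j.
Proof. by rewrite coefXM; case: j => [|j]; rewrite ?mulr0n ?coef_deriv. Qed.

Lemma coef_intrM (R : nzRingType) (z : int) (p : {poly R}) (j : nat) :
  (z%:~R * p)`_j = z%:~R * p`_j.
Proof. by rewrite -[z%:~R](rmorph_int (@polyC R)) coefCM. Qed.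

Lemma size_mulX_deriv (R : nzRingType) (p : {poly R}) :
  (size ('X * p^`())%R <= size p)%N.
Proof.
by apply/leq_sizeP => j le_pj; rewrite coef_mulX_deriv nth_default ?mul0rn.
Qed.

(** The equation is the ODE after division by a power of y and replacement of y^rho by y; here s = i
    - 1 and W = s w - tau. The constant [kappa] stands for w n - W q, and its sign enters when top
    degrees are compared. *)
Lemma bracket_equation_bound (K : fieldType) (charK : [pchar K] =i pred0)
    (f g : {poly K}) (s t : nat) (kappa rho tau w : int) :
    size f = t.+1 -> (0 < t)%N -> ~~ root f 0 ->
    0 < kappa -> 0 < rho -> 0 < tau -> 0 < w ->
    - kappa%:~R * (f * g) +
      rho%:~R * 'X * ((s%:Z * w - tau)%:~R * (g * f^`()) - w%:~R * (f * g^`()))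
      = rho%:~R * f ^+ s.+1 ->
  w <= tau * t%:Z.
Proof.
move=> size_f t_gt0 f0 kappa_gt0 rho_gt0 tau_gt0 w_gt0 eq_fg.
rewrite leNgt; apply/negP => lt_w.
have intE := intr_char0_eq0 charK.
have scale_dvd (z : int) (p q : {poly K}) : z != 0 -> (p %| z%:~R * q) = (p %| q).
  by move=> z_neq0; rewrite -[z%:~R](rmorph_int (@polyC K)) mul_polyC dvdpZr ?intE.
have f_neq0 : f != 0 by rewrite -size_poly_gt0 size_f.
have g_neq0 : g != 0.
  apply: contraNneq f_neq0 => g0; move: eq_fg.
  rewrite g0 deriv0 !(mulr0, mul0r, subr0, addr0) => /esym/eqP.
  rewrite mulf_eq0 expf_eq0 -[rho%:~R](rmorph_int (@polyC K)) polyC_eq0 intE.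
  by rewrite gt_eqF.
have coX (p : {poly K}) : p %| f -> coprimep p 'X.
  move=> pf; rewrite -['X]subr0 -polyC0 coprimep_XsubC.
  by apply: contraNN f0; rewrite -!dvdp_XsubCl => /dvdp_trans; apply.
have [fs_dvd | fs_ndvd] := boolP (f ^+ s %| g).
  have [h g_eq] := dvdpP _ _ fs_dvd.
  (* Substituting g = h f^s and cancelling f^s makes the terms with s w disappear from the
     coefficient of h f'. *)
  have eq_fh : - kappa%:~R * (f * h) -
      rho%:~R * 'X * (tau%:~R * (h * f^`()) + w%:~R * (f * h^`()))
      = rho%:~R * f.
    apply: (mulfI (expf_neq0 s f_neq0)).
    transitivity (rho%:~R * f ^+ s.+1); last by rewrite exprS; ring.
    rewrite -eq_fg g_eq; case: (s) => [|s'].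
      by rewrite !expr0 !mulr1; ring.
    rewrite derivM deriv_exp -mulr_natl !exprS /=; ring.
  have h_neq0 : h != 0 by apply: contraNneq g_neq0 => h0; rewrite g_eq h0 mul0r.
  have f'_neq0 : f^`() != 0.
    apply: contraTneq t_gt0 => /(congr1 (fun p : {poly K} => p`_t.-1)).
    case: (t) size_f => // t' size_f; rewrite coef_deriv coef0 -mulr_natr => /eqP.
    rewrite mulf_eq0 ((pcharf0P K).1 charK) orbF => /eqP ft0.
    by move: f_neq0; rewrite -lead_coef_eq0 lead_coefE size_f /= ft0 eqxx.
  (* All other terms are multiples of [f], and [f] is coprime to X, so [f] divides h f'. A constant
     h would make [f] divide the nonzero f' of smaller degree. *)
  have h_gt1 : (1 < size h)%N.
    have : f %| rho%:~R * (tau%:~R * ('X * (h * f^`()))).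
      have -> : rho%:~R * (tau%:~R * ('X * (h * f^`()))) =
          f * (- kappa%:~R * h - rho%:~R * 'X * w%:~R * h^`() - rho%:~R).
        by rewrite mulrBr [f * rho%:~R]mulrC -eq_fh; ring.
      exact: dvdp_mulr.
    rewrite !scale_dvd ?gt_eqF // Gauss_dvdpr ?coX //.
    move=> /(dvdp_leq (mulf_neq0 h_neq0 f'_neq0)).
    rewrite size_mul // size_f; have := lt_size_deriv f_neq0; rewrite size_f.
    by move: (size h) (size _); lia.
  pose d := (size h).-1.
  have size_h : size h = d.+1 by rewrite prednK // ltnW.
  have d_gt0 : (0 < d)%N by rewrite -ltnS -size_h.
  (* In degree t + d > t the right side has no term, while the three contributions on the left carry
     the integers - kappa, - rho tau t and - rho w d of the same sign, which cannot sum to zero. *)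
  move: eq_fh => /(congr1 (fun p : {poly K} => p`_(t + d))).
  have -> : - kappa%:~R * (f * h) -
      rho%:~R * 'X * (tau%:~R * (h * f^`()) + w%:~R * (f * h^`())) =
    (- kappa)%:~R * (f * h) - (rho * tau)%:~R * (('X * f^`()) * h)
       - (rho * w)%:~R * (f * ('X * h^`())) by ring.
  rewrite !coefB !coef_intrM.
  have -> : f`_(t + d) = 0 by rewrite nth_default // size_f -addn1 leq_add2l.
  rewrite mulr0.
  rewrite !coefM_top -?size_f -?size_h ?size_mulX_deriv //.
  rewrite !coef_mulX_deriv.
  have -> : (- kappa)%:~R * (f`_t * h`_d) - (rho * tau)%:~R * (f`_t *+ t * h`_d) -
        (rho * w)%:~R * (f`_t * (h`_d *+ d)) =
     - ((kappa + rho * tau * t%:Z + rho * w * d%:Z)%:~R * (f`_t * h`_d)) :> K.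
    rewrite -(mulr_natr _ t) -(mulr_natr _ d); ring.
  apply/eqP; rewrite oppr_eq0 !mulf_neq0 ?intE //.
  - apply: lt0r_neq0; rewrite !addr_gt0 ?mulr_gt0 //.
  - by move: f_neq0; rewrite -lead_coef_eq0 lead_coefE size_f.
  - by move: h_neq0; rewrite -lead_coef_eq0 lead_coefE.
have [|r [v [k [irr_r g_eq rNv r_dvd]]]] := ndvdp_irreducible_power _ g_neq0 fs_ndvd.
  by rewrite expf_neq0.
have [m [u [f_eq rNu]]] := dvdp_power_factor irr_r.1 f_neq0.
have r_neq0 := irredp_neq0 irr_r.
have lt_k : (k < s * m)%N.
  move: r_dvd; rewrite f_eq exprMn -exprM Gauss_dvdpl.
    by rewrite dvdp_Pexp2l ?irr_r.1 // mulnC.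
  by rewrite coprimep_expl // coprimep_expr // irreducible_coprime.
have m_gt0 : (0 < m)%N by case: (m) lt_k; rewrite ?muln0.
have le_mt : (m <= t)%N.
  have : r ^+ m %| f by rewrite f_eq dvdp_mulr.
  move=> /(dvdp_leq f_neq0); rewrite size_f -[size _]prednK ?size_poly_gt0 ?expf_neq0 //.
  rewrite size_exp ltnS; apply: leq_trans.
  by rewrite leq_pmull // -subn1 subn_gt0 irr_r.1.
have rf : r %| f by rewrite f_eq dvdp_mulr // dvdp_exp.
have rf' : r * f^`() = r ^+ m * (m%:Z%:~R * r^`() * u + r * u^`()).
  rewrite f_eq derivM deriv_exp -mulr_natl; case: (m) m_gt0 => // m' _ /=.
  rewrite !exprS; ring.
have rg' : r * g^`() = r ^+ k * (k%:Z%:~R * r^`() * v + r * v^`()).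
  rewrite g_eq derivM deriv_exp -mulr_natl; case: (k) => [|k'] /=.
    rewrite !expr0; ring.
  rewrite exprS; ring.
(* The integer factor of the lowest r-adic term of W g f' - w f g'. If it vanished, then tau m = w
   (s m - k) >= w > tau t >= tau m. *)
pose c : int := (s%:Z * w - tau) * m%:Z - w * k%:Z.
have c_neq0 : c != 0.
  apply/eqP => c0.
  have wc : w * (s * m - k)%:Z = tau * m%:Z.
    rewrite -subzn ?(ltnW lt_k) // PoszM; move: c0; rewrite /c; lia.
  have : w <= w * (s * m - k)%:Z by rewrite ler_peMr ?(ltW w_gt0) // lez_nat subn_gt0.
  apply/negP; rewrite -ltNge wc (le_lt_trans _ lt_w) // ler_pM2l //.
(* Multiplying the ODE by [r] makes r^(m + k) a common factor. Once it is cancelled, every term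
   except the displayed one is still a multiple of [r], the right side because k < s m. But [r]
   divides none of X, r', u, v. *)
have key : r %| rho%:~R * ('X * (c%:~R * (r^`() * (u * v)))).
  pose e := (s * m - k)%N.
  have : r ^+ (m + k) * (- kappa%:~R * (r * (u * v)) + rho%:~R * 'X *
       ((s%:Z * w - tau)%:~R * (v * (m%:Z%:~R * r^`() * u + r * u^`())) -
        w%:~R * (u * (k%:Z%:~R * r^`() * v + r * v^`())))) =
     r ^+ (m + k) * (rho%:~R * r ^+ e * r * u ^+ s.+1).
    transitivity (r * (rho%:~R * f ^+ s.+1)).
      rewrite -eq_fg; transitivity (- kappa%:~R * (r * f * g) + rho%:~R * 'X *
         ((s%:Z * w - tau)%:~R * (g * (r * f^`())) - w%:~R * (f * (r * g^`())))).
        by rewrite rf' rg' {1 2}f_eq {1 2}g_eq exprD; ring.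
      ring.
    have -> : f ^+ s.+1 = r ^+ (m + k) * r ^+ e * u ^+ s.+1.
      rewrite f_eq exprMn -exprM -exprD; congr (_ ^+ _ * _).
      by rewrite /e mulnS mulnC; lia.
    ring.
  move=> /(mulfI (expf_neq0 _ r_neq0)) eq_r.
  have -> : rho%:~R * ('X * (c%:~R * (r^`() * (u * v)))) =
     r * (rho%:~R * r ^+ e * u ^+ s.+1 + kappa%:~R * (u * v) - rho%:~R * 'X *
       ((s%:Z * w - tau)%:~R * (v * u^`()) - w%:~R * (u * v^`()))).
    rewrite mulrBr mulrDr.
    have -> : r * (rho%:~R * r ^+ e * u ^+ s.+1) = rho%:~R * r ^+ e * r * u ^+ s.+1.
      ring.
    rewrite -eq_r /c; ring.
  exact: dvdp_mulr.
move: key; rewrite scale_dvd ?gt_eqF // Gauss_dvdpr ?coX // scale_dvd //.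
rewrite Gauss_dvdpr ?irreducible_coprime_deriv //.
by rewrite Gauss_dvdpr ?irreducible_coprime // (negPf rNv).
Qed.

(** * Polynomials of the form X^n f(X^rho) and their lowest order terms *)

Lemma poly_shift_comp_Xn (R : comNzRingType) (P : {poly R}) (n rho : nat) :
    (0 < rho)%N -> (forall b, P`_b != 0 -> (n <= b)%N && (rho %| b - n)%N) ->
  exists f : {poly R},
    P = 'X^n * (f \Po 'X^rho) /\ forall j, f`_j = P`_(n + rho * j).
Proof.
move=> rho_gt0 suppP; exists (\poly_(j < size P) P`_(n + rho * j)).
have coefE j : (\poly_(k < size P) P`_(n + rho * k))`_j = P`_(n + rho * j).
  rewrite coef_poly; case: ltnP => // le_j; rewrite nth_default //.
  by apply: leq_trans le_j _; rewrite (leq_trans (leq_pmull j rho_gt0)) ?leq_addl.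
split=> //; apply/polyP => b; rewrite coefXnM coef_comp_poly_Xn // coefE.
have [lt_bn | le_nb] := ltnP b n.
  by apply: contraTeq lt_bn => /suppP /andP[]; rewrite -leqNgt.
case: ifP => dvd_b; first by rewrite mulnC divnK // subnKC.
by apply: contraFeq dvd_b => /suppP /andP[].
Qed.

Lemma comp_Xn_inj (R : comNzRingType) (rho : nat) :
  (0 < rho)%N -> injective (fun p : {poly R} => p \Po 'X^rho).
Proof.
move=> rho_gt0 p q eq_pq; apply/polyP => j.
have := congr1 (fun u : {poly R} => u`_(j * rho)) eq_pq.
by rewrite /= !coef_comp_poly_Xn // dvdn_mull // mulnK.
Qed.

Lemma comp_poly_natM (R : comNzRingType) (n : nat) (p q : {poly R}) :
  (n%:R * p) \Po q = n%:R * (p \Po q).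
Proof. by rewrite comp_polyM rmorph_nat. Qed.

Lemma comp_poly_intM (R : comNzRingType) (z : int) (p q : {poly R}) :
  (z%:~R * p) \Po q = z%:~R * (p \Po q).
Proof. by rewrite comp_polyM rmorph_int. Qed.

(** Unlike d/dX, the operator X d/dX preserves the form X^n u(X^rho): it acts on u as n + rho X
    d/dX. *)
Lemma mulX_deriv_shift_comp_Xn (R : comNzRingType) (f : {poly R}) (n rho : nat) :
  (0 < rho)%N ->
  'X * ('X^n * (f \Po 'X^rho))^`() =
  'X^n * ((n%:R * f + rho%:R * 'X * f^`()) \Po 'X^rho).
Proof.
move=> rho_gt0; rewrite derivM deriv_comp !derivXn comp_polyD comp_poly_natM.
rewrite -mulrA comp_poly_natM comp_polyM comp_polyX.
rewrite -(mulr_natl 'X^(n.-1) n) -(mulr_natl 'X^(rho.-1) rho).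
have X_rho : 'X^rho = 'X * 'X^(rho.-1) :> {poly R} by rewrite -exprS prednK.
have X_n : n%:R * 'X * 'X^(n.-1) = n%:R * 'X^n :> {poly R}.
  by case: n => [|n]; rewrite ?mul0r // -mulrA -exprS.
transitivity (n%:R * 'X * 'X^(n.-1) * (f \Po 'X^rho) +
  'X^n * ((f^`() \Po 'X^rho) * (rho%:R * ('X * 'X^(rho.-1))))); first by ring.
by rewrite X_n -X_rho; ring.
Qed.

Lemma mulXn_eq (R : idomainType) (A B : {poly R}) (a b : nat) :
  A`_0 != 0 -> B`_0 != 0 -> 'X^a * A = 'X^b * B -> a = b /\ A = B.
Proof.
have aux (C D : {poly R}) (c d : nat) :
    C`_0 != 0 -> 'X^c * C = 'X^d * D -> (d <= c)%N.
  move=> C0 /(congr1 (fun p : {poly R} => p`_c)).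
  rewrite !coefXnM ltnn subnn leqNgt; case: ltnP => // _ C0'.
  by rewrite C0' eqxx in C0.
move=> A0 B0 eqAB; have eq_ab : a = b.
  by apply/eqP; rewrite eqn_leq (aux _ _ _ _ A0 eqAB) (aux _ _ _ _ B0 (esym eqAB)).
by split=> //; move: eqAB; rewrite eq_ab => /mulfI; apply; rewrite expf_neq0 ?polyX_eq0.
Qed.

(** Multiplied by X, the two sides become X^(q + n) A(X^rho) and X^(q (s + 1) + 1) B(X^rho) with
    B(0) nonzero and A(0) = (W q - w n) f(0) g(0). Either A(0) vanishes, or the orders at 0 agree
    and A = B. *)
Lemma bracket_equation_dichotomy (K : fieldType) (charK : [pchar K] =i pred0)
    (f g : {poly K}) (q n rho s : nat) (W w : int) :
    (0 < rho)%N -> f`_0 != 0 -> g`_0 != 0 ->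
    let P := 'X^q * (f \Po 'X^rho) in
    let Q := 'X^n * (g \Po 'X^rho) in
    W%:~R * Q * P^`() - w%:~R * P * Q^`() = rho%:R * P ^+ s.+1 ->
  W * q%:Z = w * n%:Z \/
  n = (s * q).+1 /\
  (W * q%:Z - w * n%:Z)%:~R * (f * g) +
    rho%:R * 'X * (W%:~R * (g * f^`()) - w%:~R * (f * g^`()))
  = rho%:R * f ^+ s.+1.
Proof.
move=> rho_gt0 f0 g0 P Q eqPQ; have intE := intr_char0_eq0 charK.
have [-> | neq_W] := eqVneq (W * q%:Z) (w * n%:Z); [by left | right].
set A := (X in _ /\ X = _); set B := (X in _ /\ _ = X).
have eqAB : 'X^(q + n) * (A \Po 'X^rho) = 'X^((q * s.+1).+1) * (B \Po 'X^rho).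
  transitivity ('X * (rho%:R * P ^+ s.+1)); last first.
    by rewrite /B /P comp_poly_natM rmorphXn /= exprMn -exprM [X in _ = X * _]exprS;
      rewrite -mulrA; congr (_ * _); rewrite mulrCA.
  rewrite -eqPQ.
  transitivity (W%:~R * Q * ('X * P^`()) - w%:~R * P * ('X * Q^`())); last by ring.
  rewrite !mulX_deriv_shift_comp_Xn // /P /Q /A !comp_polyD -!mulrA !comp_poly_natM.
  rewrite comp_poly_intM !comp_polyM comp_polyB !comp_poly_intM !comp_polyM exprD.
  ring.
have coef0M (C D : {poly K}) : (C * D)`_0 = C`_0 * D`_0 by rewrite coefM big_ord1.
have comp0 (C : {poly K}) : (C \Po 'X^rho)`_0 = C`_0.
  by rewrite coef_comp_poly_Xn // dvdn0 div0n.
have A0 : (A \Po 'X^rho)`_0 != 0.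
  rewrite comp0 /A coefD coef_intrM !coef0M coefX /= !(mulr0, mul0r) addr0.
  by rewrite !mulf_neq0 // intE subr_eq0.
have B0 : (B \Po 'X^rho)`_0 != 0.
  rewrite comp0 /B -polyC_natr coefCM mulf_neq0 //.
    by rewrite ((pcharf0P K).1 charK) -lt0n.
  by elim: (s.+1) => [|m IHm]; rewrite ?coef1 ?oner_neq0 // exprS coef0M mulf_neq0.
have [eq_exp /(comp_Xn_inj rho_gt0) eq_AB] := mulXn_eq A0 B0 eqAB.
by split=> //; lia.
Qed.

(** * Euler's identity and the weight of a bracket *)

Lemma mulX_mderiv (R : comNzRingType) (n : nat) (i : 'I_n) (P : {mpoly R[n]}) :
  'X_i * P^`M(i) = \sum_(m <- msupp P) P@_m *: ((m i)%:R * 'X_[m]).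
Proof.
rewrite {1}[P]mpolyE linear_sum mulr_sumr; apply: eq_bigr => m _ /=.
rewrite mderivZ -scalerAr mderivX -scalerAr -mpolyXD; congr (_ *: _).
case m_i: (m i) => [|k]; first by rewrite mul0r scale0r.
rewrite scaler_nat mulr_natl; congr ('X_[_] *+ _).
by rewrite addmC submK // lep1mP m_i.
Qed.

Definition wt (d : direction) (m : 'X_{1..2}) : int := v d (m ord0, m ord_max).

Lemma homogeneous_wt (K : fieldType) (d : direction) (P : {mpoly K[2]}) m m' :
  homogeneous d P -> m \in msupp P -> m' \in msupp P -> wt d m = wt d m'.
Proof.
move=> homP mP m'P; apply: homP.
  exact: (map_f (fun m : 'X_{1..2} => (m ord0, m ord_max))).
exact: (map_f (fun m : 'X_{1..2} => (m ord0, m ord_max))).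
Qed.

Lemma euler_homogeneous (K : fieldType) (d : direction) (P : {mpoly K[2]}) m0 :
  homogeneous d P -> m0 \in msupp P ->
  d.1%:~R * ('X_ord0 * P^`M(ord0)) + d.2%:~R * ('X_ord_max * P^`M(ord_max)) =
  (wt d m0)%:~R * P.
Proof.
move=> homP m0P; rewrite !mulX_mderiv [in RHS](mpolyE P) !mulr_sumr -big_split.
apply: eq_big_seq => m mP /=; rewrite (homogeneous_wt homP m0P mP) -!scalerAr -scalerDr.
by rewrite /wt /v /=; congr (_ *: _); ring.
Qed.

Lemma mderiv_var (R : nzRingType) (n : nat) (i j : 'I_n) :
  ('X_i : {mpoly R[n]})^`M(j) = (i == j)%:R.
Proof.
rewrite mderivX mnm1E; case: eqP => [->|_]; last by rewrite scale0r.
by rewrite scale1r -mpolyX0; congr 'X_[_]; apply/mnmP => k; rewrite mnmBE subnn mnm0E.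
Qed.

Lemma ord2P (j : 'I_2) : j = ord0 \/ j = ord_max.
Proof. by case: j => [[|[|j]] ?] //; [left | right]; apply: val_inj. Qed.

(** The weighted Euler operator [E] is a derivation, and the partial derivatives lower eigenvalues
    by rho and sigma. Both sides of the bracket equation are thus eigenvectors, and a nonzero
    element has only one eigenvalue. *)
Lemma bracket_weight (K : fieldType) (charK : [pchar K] =i pred0) (rho sigma : int)
    (G R : {mpoly K[2]}) (a b : int) (i : nat) :
    let E P := rho%:~R * ('X_ord0 * P^`M(ord0)) +
               sigma%:~R * ('X_ord_max * P^`M(ord_max)) : {mpoly K[2]} in
    R != 0 -> E G = a%:~R * G -> E R = b%:~R * R -> bracket G R = R ^+ i ->
  a + b - rho - sigma = i%:Z * b.
Proof.
move=> E R_neq0 EG ER brGR.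
have EB P Q : E (P - Q) = E P - E Q by rewrite /E !mderivB; ring.
have EM P Q : E (P * Q) = E P * Q + P * E Q by rewrite /E !mderivM; ring.
have E_mderiv P c (j : 'I_2) : E P = c%:~R * P ->
    E P^`M(j) = (c - (if j == ord0 then rho else sigma))%:~R * P^`M(j).
  have mderiv_intM (z : int) (Q : {mpoly K[2]}) : (z%:~R * Q)^`M(j) = z%:~R * Q^`M(j).
    by rewrite -[z%:~R](rmorph_int (@mpolyC 2 K)) mderiv_mulC.
  move=> /(congr1 (mderiv j)).
  rewrite /E mderivD !mderiv_intM !mderivM !mderiv_var => eqEP.
  rewrite intrB mulrBl -eqEP (mderiv_comm ord0 j) (mderiv_comm ord_max j).
  by have [->|->] := ord2P j; rewrite /=; ring.
have E_bracket : E (bracket G R) = (a + b - rho - sigma)%:~R * bracket G R.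
  by rewrite /bracket EB !EM !(E_mderiv _ _ _ EG) !(E_mderiv _ _ _ ER) /=; ring.
have E_exp : E (R ^+ i) = (i%:Z * b)%:~R * R ^+ i.
  elim: (i) => [|k IHk].
    by rewrite mul0r mulr0z mul0r expr0 /E !mderivC !mulr0 addr0.
  by rewrite exprS EM ER IHk intS; ring.
move: E_exp; rewrite -brGR E_bracket => /eqP; rewrite -subr_eq0 -mulrBl -intrB mulf_eq0.
rewrite -[X in X == 0](rmorph_int (@mpolyC 2 K)) mpolyC_eq0 intr_char0_eq0 // brGR.
by rewrite expf_eq0 (negPf R_neq0) andbF orbF subr_eq0 => /eqP.
Qed.

(** * Setting x = 1 in homogeneous polynomials *)

Local Notation dehomogenize :=
  (mmap polyC (fun i : 'I_2 => if i == ord0 then 1 else 'X)).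

Lemma dehomogenizeE (K : fieldType) (P : {mpoly K[2]}) :
  dehomogenize P = \sum_(m <- msupp P) P@_m *: 'X^(m ord_max).
Proof.
apply: eq_bigr => m _; rewrite mul_polyC; congr (_ *: _).
by rewrite /mmap1 big_ord_recl big_ord1 /= expr1n mul1r; congr ('X^(m _)); apply: val_inj.
Qed.

Lemma dehomogenizeZX (K : fieldType) (c : K) m :
  dehomogenize (c *: 'X_[m]) = c *: 'X^(m ord_max).
Proof.
rewrite mmapZ mmapX mul_polyC /mmap1 big_ord_recl big_ord1 /= expr1n mul1r.
by congr (_ *: 'X^(m _)); apply: val_inj.
Qed.

Lemma dehomogenize_mderiv (K : fieldType) (P : {mpoly K[2]}) :
  dehomogenize P^`M(ord_max) = (dehomogenize P)^`().
Proof.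
rewrite [in RHS]dehomogenizeE {1}[P]mpolyE linear_sum !raddf_sum; apply: eq_bigr => m _ /=.
rewrite mderivZ mderivX scalerA dehomogenizeZX derivZ derivXn mnmBE mnm1E eqxx subn1.
by rewrite -scaler_nat scalerA.
Qed.

(** With rho nonzero, the y-exponent and the weight determine the x-exponent, so setting x = 1
    merges no terms. *)
Lemma coef_dehomogenize (K : fieldType) (d : direction) (P : {mpoly K[2]}) m :
  d.1 != 0 -> homogeneous d P -> m \in msupp P ->
  (dehomogenize P)`_(m ord_max) = P@_m.
Proof.
move=> d1_neq0 homP mP; rewrite dehomogenizeE coef_sum (bigD1_seq m) ?msupp_uniq //=.
rewrite coefZ coefXn eqxx mulr1 big_seq_cond big1 ?addr0 // => m' /andP[m'P m'_neq].
rewrite coefZ coefXn; case: eqP => [eq_y|]; last by rewrite mulr0.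
case/eqP: m'_neq; apply/mnmP => j.
have /eqP := homogeneous_wt homP m'P mP; rewrite /wt /v /= -eq_y.
rewrite (inj_eq (addIr _)) (inj_eq (mulfI d1_neq0)) eqz_nat => /eqP eq_x.
by have [->|->] := ord2P j.
Qed.

Lemma dehomogenize_supp (K : fieldType) (P : {mpoly K[2]}) (b : nat) :
  (dehomogenize P)`_b != 0 -> exists2 m, m \in msupp P & b = m ord_max.
Proof.
move=> Pb; have [/hasP[m mP /eqP <-] | noP] :=
  boolP (has (fun m : 'X_{1..2} => m ord_max == b) (msupp P)); first by exists m.
case/eqP: Pb; rewrite dehomogenizeE coef_sum big_seq big1 // => m mP.
rewrite coefZ coefXn eq_sym (negPf (hasPn noP m mP)) mulr0 //.
Qed.

Lemma wt_eq_dvd (d : direction) (m m' : point) :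
  coprimez d.1 d.2 -> v d m = v d m' -> (d.1 %| m.2%:Z - m'.2%:Z)%Z.
Proof.
move=> co_d eq_v; rewrite -(Gauss_dvdzr _ co_d).
apply/dvdzP; exists (m'.1%:Z - m.1%:Z); move: eq_v; rewrite /v; lia.
Qed.

Lemma dehomogenize_euler (K : fieldType) (d : direction) (P : {mpoly K[2]}) m :
  homogeneous d P -> m \in msupp P ->
  d.1%:~R * dehomogenize P^`M(ord0) =
  (wt d m)%:~R * dehomogenize P - d.2%:~R * ('X * (dehomogenize P)^`()).
Proof.
move=> homP mP; have := congr1 dehomogenize (euler_homogeneous homP mP).
rewrite rmorphD !rmorphM !rmorph_int /= !mmapX !mmap1U /= mul1r dehomogenize_mderiv => <-.
by rewrite addrK.
Qed.

(** Euler's identity at x = 1 eliminates both x-derivatives, and the two products sigma y G' R' that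
    arise cancel. *)
Lemma dehomogenize_bracket (K : fieldType) (d : direction) (G R : {mpoly K[2]}) g m :
  homogeneous d G -> homogeneous d R -> g \in msupp G -> m \in msupp R ->
  d.1%:~R * dehomogenize (bracket G R) =
  (wt d g)%:~R * dehomogenize G * (dehomogenize R)^`() -
  (wt d m)%:~R * dehomogenize R * (dehomogenize G)^`().
Proof.
move=> homG homR gG mR; rewrite /bracket rmorphB !rmorphM /= !dehomogenize_mderiv.
rewrite mulrBr !mulrA (dehomogenize_euler homG gG) (dehomogenize_euler homR mR).
ring.
Qed.

Lemma min_msupp (K : fieldType) (P : {mpoly K[2]}) : P != 0 ->
  exists2 m, m \in msupp P &
    {in msupp P, forall m' : 'X_{1..2}, (m ord_max <= m' ord_max)%N}.
Proof.
rewrite -msupp_eq0 -size_eq0 -lt0n -has_predT => /hasP[m0 m0P _].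
have ex_n : exists n, has (fun m : 'X_{1..2} => m ord_max == n) (msupp P).
  by exists (m0 ord_max); apply/hasP; exists m0.
have [n /hasP[m mP /eqP <-] min_n] := ex_minnP ex_n.
by exists m => // m' m'P; apply: min_n; apply/hasP; exists m'.
Qed.

(** Since rho and sigma are coprime, the y-exponents of a homogeneous polynomial are all congruent
    modulo rho. *)
Lemma dehomogenize_shift (K : fieldType) (d : direction) (r : nat)
    (P : {mpoly K[2]}) m :
    d.1 = r%:Z -> (0 < r)%N -> coprimez d.1 d.2 -> homogeneous d P ->
    m \in msupp P ->
    {in msupp P, forall m' : 'X_{1..2}, (m ord_max <= m' ord_max)%N} ->
  exists f : {poly K},
    dehomogenize P = 'X^(m ord_max) * (f \Po 'X^r) /\
    forall j, f`_j = (dehomogenize P)`_(m ord_max + r * j).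
Proof.
move=> d_r r_gt0 co_d homP mP min_m; apply: poly_shift_comp_Xn => // b Pb.
have [m' m'P ->] := dehomogenize_supp Pb; rewrite min_m //=.
have := wt_eq_dvd co_d (homogeneous_wt homP m'P mP).
by rewrite d_r /= subzn ?min_m.
Qed.

Lemma supp_msupp (K : fieldType) (P : {mpoly K[2]}) (p : point) :
  p \in supp P -> exists2 m, m \in msupp P & p = (m ord0, m ord_max).
Proof. by case/mapP => m mP ->; exists m. Qed.

Lemma mem_supp (K : fieldType) (P : {mpoly K[2]}) m :
  m \in msupp P -> ((m : 'X_{1..2}) ord0, m ord_max) \in supp P.
Proof. exact: (map_f (fun m : 'X_{1..2} => (m ord0, m ord_max))). Qed.

(** * One edge of a chain *)

(** For t > 0, the last alternative comes from cancellation of the lowest order terms of the ODE;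
    otherwise [bracket_equation_bound] gives w <= tau t. *)
Lemma chain_step (K : fieldType) (charK : [pchar K] =i pred0) (d : direction)
    (R G : {mpoly K[2]}) (p p' : point) (i : nat) :
    in_D d -> homogeneous d R -> is_st R p -> is_en R p' -> d.1 <= v d p' ->
    homogeneous d G -> (0 < i)%N -> bracket G R = R ^+ i ->
  exists t : nat,
    [/\ p'.1%:Z = p.1%:Z - d.2 * t%:Z, p'.2%:Z = p.2%:Z + d.1 * t%:Z,
        d.1 <= v d p &
        [\/ t = 0%N, v d p <= - (d.1 + d.2) * t%:Z | d.1 <= p.1%:Z - p.2%:Z]].
Proof.
move=> [co_d d1_gt0 d12_lt0] homR [pR min_p] [p'R max_p'] le_v homG.
case: i => // s _ brGR.
have eq_v : v d p' = v d p by apply: homR.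
rewrite eq_v in le_v.
have [m mR p_eq] := supp_msupp pR; have [m' m'R p'_eq] := supp_msupp p'R.
have [r d_r] : exists r : nat, d.1 = r%:Z by exists `|d.1|%N; rewrite gtz0_abs.
have r_gt0 : (0 < r)%N by rewrite -ltz_nat -d_r.
have [t p'2] : exists t : nat, p'.2 = (p.2 + r * t)%N.
  have := wt_eq_dvd co_d eq_v; rewrite d_r subzn ?min_p // => /dvdnP[t eq_t].
  by exists t; rewrite mulnC -eq_t subnKC ?min_p.
have p'1 : p'.1%:Z = p.1%:Z - d.2 * t%:Z.
  apply: (mulfI (lt0r_neq0 d1_gt0)).
  move: eq_v; rewrite /v p'2 d_r PoszD PoszM => eq_v.
  have -> : r%:Z * p'.1%:Z = r%:Z * p.1%:Z + d.2 * p.2%:Z - d.2 * (p.2%:Z + r%:Z * t%:Z).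
    by rewrite -eq_v addrK.
  ring.
exists t; split=> //; first by rewrite p'2 d_r PoszD PoszM.
have [-> | t_gt0] := posnP t; first exact: Or31.
set w := v d p; have w_gt0 : 0 < w := lt_le_trans d1_gt0 le_v.
have wt_m : wt d m = w by rewrite /w p_eq.
have R_neq0 : R != 0 by apply: contraTneq mR => ->; rewrite msupp0.
have G_neq0 : G != 0.
  apply: contraNneq (expf_neq0 s.+1 R_neq0) => G0.
  by rewrite -brGR G0 /bracket !mderiv0 mul0r mulr0 subrr.
have [g gG min_g] := min_msupp G_neq0.
set W := wt d g; set n := g ord_max.
have W_eq : W = s%:Z * w - - (d.1 + d.2).
  have := bracket_weight charK R_neq0 (euler_homogeneous homG gG)
            (euler_homogeneous homR mR) brGR.
  rewrite -/W wt_m intS; lia.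
have [|f [P_eq f_coef]] := dehomogenize_shift d_r r_gt0 co_d homR mR.
  by move=> m1 m1R; have := min_p _ (mem_supp m1R); rewrite p_eq.
have [g1 [Q_eq g1_coef]] := dehomogenize_shift d_r r_gt0 co_d homG gG min_g.
have coefE (P : {mpoly K[2]}) m1 : homogeneous d P -> m1 \in msupp P ->
    (dehomogenize P)`_(m1 ord_max) != 0.
  by move=> homP m1P; rewrite (coef_dehomogenize _ homP) ?lt0r_neq0 // -mcoeff_msupp.
have f0 : f`_0 != 0 by rewrite f_coef muln0 addn0 coefE.
have g10 : g1`_0 != 0 by rewrite g1_coef muln0 addn0 coefE.
have m2 : m ord_max = p.2 by rewrite p_eq.
have m'2 : m' ord_max = p'.2 by rewrite p'_eq.
have size_f : size f = t.+1.
  apply/eqP; rewrite eqn_leq; apply/andP; split.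
    apply/leq_sizeP => j lt_tj; apply/eqP; rewrite f_coef; apply: contraTT lt_tj.
    move=> /dehomogenize_supp[m1 m1R]; have := max_p' _ (mem_supp m1R).
    by rewrite /= m2 p'2 => /[swap] <-; rewrite leq_add2l leq_pmul2l // -leqNgt.
  apply: contraTT (coefE R m' homR m'R); rewrite -leqNgt => le_ft.
  by rewrite m'2 p'2 -m2 -f_coef nth_default ?eqxx.
have bracket_eq := dehomogenize_bracket homG homR gG mR.
rewrite brGR rmorphXn /= -/W wt_m P_eq Q_eq d_r in bracket_eq.
have [eq_W | [n_eq eq_fg]] :=
    bracket_equation_dichotomy charK r_gt0 f0 g10 (esym bracket_eq).
  apply: Or33.
  (* The point (s p + 1, s q + 1) has weight s w + rho + sigma = W, the weight of G, so its second
     coordinate is congruent to n modulo rho. *)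
  have /dvdzP[z z_eq] : (d.1 %| n%:Z - ((s * p.2).+1)%:Z)%Z.
    apply: (@wt_eq_dvd d (g ord0, n) ((s * p.1).+1, (s * p.2).+1)) => //.
    rewrite -[LHS]/W W_eq /w /v /=; rewrite !intS !PoszM; ring.
  move: z_eq eq_W; rewrite intS PoszM m2 W_eq -/w => z_eq eq_W.
  have n_eq : n%:Z = 1 + s%:Z * p.2%:Z + z * d.1 by rewrite -z_eq; ring.
  (* Inserting n = 1 + s q + z rho into W q = w n. As tau q >= 0 this forces z < 0, and rho (p - q)
     = w + tau q then gives p - q = - z w >= w >= rho. *)
  have tau_q : - (d.1 + d.2) * p.2%:Z = - (1 + z * d.1) * w.
    transitivity (- ((s%:Z * w - - (d.1 + d.2)) * p.2%:Z) + s%:Z * w * p.2%:Z).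
      by ring.
    by rewrite eq_W n_eq; ring.
  have z_lt0 : z < 0.
    rewrite ltNge; apply/negP => z_ge0.
    have : 0 <= - (d.1 + d.2) * p.2%:Z by rewrite mulr_ge0 // oppr_ge0 ltW.
    by rewrite tau_q mulNr oppr_ge0 leNgt mulr_gt0 // ltr_pwDl // mulr_ge0 // ltW.
  have diag : p.1%:Z - p.2%:Z = - z * w.
    apply: (mulfI (lt0r_neq0 d1_gt0)).
    transitivity (w + - (d.1 + d.2) * p.2%:Z); first by rewrite /w /v; ring.
    by rewrite tau_q; ring.
  by rewrite diag (le_trans le_v) // ler_peMl ?(ltW w_gt0) // -gtz0_ge1 oppr_gt0.
apply: Or32; set tau := - (d.1 + d.2) in W_eq *.
have tau_gt0 : 0 < tau by rewrite oppr_gt0.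
(* This is w n - W q for n = s q + 1. *)
have kappa_gt0 : 0 < w + tau * p.2%:Z by rewrite ltr_pwDl // mulr_ge0 // ltW.
apply: (@bracket_equation_bound _ charK f g1 s t _ _ _ _ size_f t_gt0 _
         kappa_gt0 d1_gt0 tau_gt0 w_gt0).
  by rewrite rootE horner_coef0.
have -> : - (w + tau * p.2%:Z)%:~R = (W * (m ord_max)%:Z - w * n%:Z)%:~R :> {poly K}.
  by rewrite -rmorphN; congr (_%:~R); rewrite /n n_eq m2 W_eq intS PoszM; ring.
by rewrite -W_eq d_r.
Qed.

(** * The integer inequality and the induction along the chain *)

(** With m = p - q - 1 and T = tau t, the edge changes m to m + T and q to q + r t, so the claim is
    q + r t <= (m + T)^2; each alternative bounds r t. *)
Lemma corner_step_bound (p q r tau t : int) :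
    0 <= q -> 0 < r -> 0 < tau -> 0 <= t -> q < p -> q <= (p - q - 1) ^+ 2 ->
    r <= r * p - (r + tau) * q ->
    [\/ t = 0, r * p - (r + tau) * q <= tau * t | r <= p - q] ->
  let p' := p + (r + tau) * t in let q' := q + r * t in
  q' < p' /\ q' <= (p' - q' - 1) ^+ 2.
Proof.
move=> q_ge0 r_gt0 tau_gt0 t_ge0 lt_qp le_q le_r cases p' q'.
have [m p_eq] : exists m, p = q + m + 1 by exists (p - q - 1); ring.
have {lt_qp} m_ge0 : 0 <= m by lia.
have T_ge0 : 0 <= tau * t by rewrite mulr_ge0 // ltW.
have diag : p' - q' - 1 = m + tau * t by rewrite /p' /q' p_eq; ring.
have {}le_q : q <= m ^+ 2 by move: le_q; rewrite p_eq; congr (_ <= _ ^+ 2); ring.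
split; first by lia.
rewrite diag /q'; case: cases => [-> | le_w | le_r_m].
- by rewrite !mulr0 !addr0.
- have le_rm : r * (m + 1) <= tau * (t + q) by move: le_w; rewrite p_eq; lia.
  (* The factor m + 1 brings in r t (m + 1) <= T t + T q <= T^2 + T m^2; what then remains is a sum
     of nonnegative products of m and T. *)
  rewrite -(ler_pM2l (_ : 0 < m + 1)); last by lia.
  have : t * (r * (m + 1)) <= t * (tau * (t + q)) by rewrite ler_wpM2l.
  have : tau * t * t <= tau * t * (tau * t).
    by rewrite ler_wpM2l // ler_peMl //; lia.
  have : tau * t * q <= tau * t * m ^+ 2 by rewrite ler_wpM2l.
  have : (m + 1) * q <= (m + 1) * m ^+ 2 by rewrite ler_wpM2l //; lia.
  have : 0 <= m * (tau * t) ^+ 2 by rewrite mulr_ge0 // sqr_ge0.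
  have : 0 <= m ^+ 2 * (tau * t) by rewrite mulr_ge0 // sqr_ge0.
  have : 0 <= m * (tau * t) by rewrite mulr_ge0.
  lia.
- have le_rm : r <= m + 1 by move: le_r_m; rewrite p_eq; lia.
  (* Here q + r t <= m^2 + m t + t <= (m + t)^2 <= (m + T)^2, using t <= t^2 for integers. *)
  have : r * t <= (m + 1) * t by rewrite ler_wpM2r.
  have le_tT : t <= tau * t by rewrite ler_peMl //; lia.
  have : (m + t) ^+ 2 <= (m + tau * t) ^+ 2.
    by rewrite ler_sqr ?nnegrE ?addr_ge0 // lerD2l.
  have : t <= t ^+ 2 by rewrite expr2; nia.
  have : 0 <= m * t by rewrite mulr_ge0.
  rewrite sqrrD; lia.
Qed.

Theorem proposition3p26 (K : fieldType) (charK : [pchar K] =i pred0)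
    (a b : nat) (hab : possible_last_lower_corner K (a, b)) :
  (b < a)%N /\ b%:Z <= (a%:Z - b%:Z - 1) ^+ 2.
Proof.
have [k [C [R [d [chain C_k]]]]] := hab.
(* Every corner satisfies the bound; at (l, 0) it reads 0 <= (l - 1)^2. *)
have bound j : (j <= k)%N -> (C j).2%:Z < (C j).1%:Z /\
    (C j).2%:Z <= ((C j).1%:Z - (C j).2%:Z - 1) ^+ 2.
  elim: j => [_ | j IHj lt_jk].
    have [l [l_gt0 ->]] := chain_start chain; split=> //=; exact: sqr_ge0.
  have [lt_C le_C] := IHj (ltnW lt_jk); have j1 : (1 <= j.+1 <= k)%N by [].
  have [G [i [homG i_gt0 brGR]]] := chain_bracket chain j1.
  have dD := chain_dir chain j1; have [_ d1_gt0 d12_lt0] := dD.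
  have [t [C1 C2 le_d cases]] := chain_step charK dD (chain_homog chain j1).1
    (chain_st chain j1) (chain_en chain j1) (chain_val chain j1) homG i_gt0 brGR.
  pose tau := - ((d j.+1).1 + (d j.+1).2).
  have -> : (C j.+1).1%:Z = (C j).1%:Z + ((d j.+1).1 + tau) * t%:Z.
    by rewrite C1 /tau; ring.
  have v_eq : v (d j.+1) (C j) =
      (d j.+1).1 * (C j).1%:Z - ((d j.+1).1 + tau) * (C j).2%:Z.
    by rewrite /v /tau; ring.
  rewrite v_eq in le_d cases; rewrite C2.
  apply: (corner_step_bound (tau := tau)) => //; first by rewrite oppr_gt0.
  by case: cases => [-> | ? | ?]; [exact: Or31 | exact: Or32 | exact: Or33].
by have := bound k (leqnn k); rewrite C_k.
Qed.
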